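(* For each number $n\in\mathbb N$, the Bachmann-Howard derivative of $\mathsf T^0_n$ is given by $(\mathsf T^0_{n+1},\iota^n,\vartheta^n)$, i.e. this tuple is a Bachmann-Howard derivative of the $\mathsf{LO}$-dilator $\mathsf T^0_n$. Here $\iota^n$ and $\vartheta^n$ denote the families of functions $\iota^n_X:X\to\mathsf T^0_{n+1}(X)$ and $\vartheta^n_X:\mathsf T^0_n(\mathsf T^0_{n+1}(X))\to\mathsf T^0_{n+1}(X)$, indexed by the linear order $X$, that are defined in the context.
   Context: Term systems: given a linear order $X$, a set $\mathsf T(X)$ of terms and a function $S:\mathsf T(X)\to\mathbb N\cup\{-1\}$ are generated by simultaneous recursion: (i) for each $x\in X$ there is a term $\overline x\in\mathsf T(X)$ with $S(\overline x)=-1$; (ii) given $s\in\mathsf T(X)$ and $i\in\mathbb N$ with $i\geq\max\{S(s)-1,0\}$, there is a term $\vartheta_is\in\mathsf T(X)$ with $S(\vartheta_is)=i$. For $i\in\mathbb N\cup\{-1\}$ define $k_i:\mathsf T(X)\to\mathsf T(X)$ by $k_i(\overline x)=\overline x$, $k_i(\vartheta_js)=\vartheta_js$ if $j\leq i$, and $k_i(\vartheta_js)=k_i(s)$ if $j>i$. The relation $s<_{\mathsf T(X)}t$ holds if and only if one of the following applies: (i') $s=\overline x$, $t=\overline y$ and $x<_Xy$; (ii') $s$ is of the form $\overline x$ and $t$ of the form $\vartheta_jt'$; (iii') $s=\vartheta_is'$, $t=\vartheta_jt'$ and one of the following holds: $i<j$; or $i=j$, $s'<_{\mathsf T(X)}t'$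 and $k_i(s')<_{\mathsf T(X)}t$; or $i=j$ and $s\leq_{\mathsf T(X)}k_j(t')$ (where $\leq_{\mathsf T(X)}$ means $<_{\mathsf T(X)}$ or equality of terms). This is a linear order. The suborder $\mathsf T_n(X)\subseteq\mathsf T(X)$ consists of the terms that contain only indices $i<n$, and $\mathsf T^0_n(X)=\{s\in\mathsf T_n(X)\mid S(s)\leq 0\}$. Dilator structure: $k_{-1}(s)$ always has the form $\overline x$ with $x\in X$; put $\underline k(s)=x$ if $k_{-1}(s)=\overline x$. For an order embedding $f:X\to Y$ define $\mathsf T(f)(\overline x)=\overline{f(x)}$ and $\mathsf T(f)(\vartheta_is)=\vartheta_i\mathsf T(f)(s)$, and let $\mathsf T^0_n(f):\mathsf T^0_n(X)\to\mathsf T^0_n(Y)$ be the restriction. Put $\operatorname{supp}_X(s)=\{\underline k(s)\}$. This makes $\mathsf T^0_n$ an $\mathsf{LO}$-dilator. Functions: define $\sigma^n_X:\mathsf T_n(\mathsf T^0_{n+1}(X))\to\mathsf T_{n+1}(X)$ by $\sigma^n_X(\overline r)=r$ for $r\in\mathsf T^0_{n+1}(X)$ and $\sigma^n_X(\vartheta_is)=\vartheta_{i+1}\sigma^n_X(s)$. Define $\vartheta^n_X:\mathsf T^0_n(\mathsf T^0_{n+1}(X))\to\mathsf T^0_{n+1}(X)$ by $\vartheta^n_X(s)=\vartheta_0\sigma^n_X(s)$ and $\iota^n_X:X\to\mathsf T^0_{n+1}(X)$ by $\iota^n_X(x)=\overline x$. General notions: $\mathsf{LO}$ is the category of linear orders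 with order embeddings as morphisms; $[X]^{<\omega}$ is the set of finite subsets of $X$, with $[f]^{<\omega}(a)=\{f(x)\mid x\in a\}$. An $\mathsf{LO}$-dilator consists of a functor $D:\mathsf{LO}\to\mathsf{LO}$ and a natural transformation $\operatorname{supp}^D:D\Rightarrow[\cdot]^{<\omega}$ such that, for any $\mathsf{LO}$-morphism $f:X\to Y$ and $\sigma\in D(Y)$, $\operatorname{supp}^D_Y(\sigma)\subseteq\operatorname{rng}(f)$ implies $\sigma\in\operatorname{rng}(D(f))$. A Bachmann-Howard fixed point of $D$ over a linear order $X$ consists of a linear order $Z$ and functions $\iota:X\to Z$ and $\vartheta:D(Z)\to Z$ such that: (1) $\iota$ is an order embedding; (2) $\iota(x)<_Z\vartheta(\sigma)$ for all $x\in X$, $\sigma\in D(Z)$; (3) if $\sigma<_{D(Z)}\tau$ and $z<_Z\vartheta(\tau)$ for all $z\in\operatorname{supp}^D_Z(\sigma)$, then $\vartheta(\sigma)<_Z\vartheta(\tau)$; furthermore, $z<_Z\vartheta(\sigma)$ for any $z\in\operatorname{supp}^D_Z(\sigma)$. It is initial if for any Bachmann-Howard fixed point $(Z',\iota',\vartheta')$ of $D$ over $X$ there is a unique order embedding $f:Z\to Z'$ with $f\circ\iota=\iota'$ and $f\circ\vartheta=\vartheta'\circ D(f)$. A Bachmann-Howard derivative of $D$ consists of an $\mathsf{LO}$-dilator $E$ and families of functions $\iota_X:X\to E(X)$ and $\vartheta_X:D(E(X))\to E(X)$, indexed by linear orders $X$, such that each $(E(X),\iota_X,\vartheta_X)$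 is an initial Bachmann-Howard fixed point of $D$ over $X$, and such that for any order embedding $f:X\to Y$ we have $E(f)\circ\iota_X=\iota_Y\circ f$ and $E(f)\circ\vartheta_X=\vartheta_Y\circ D(E(f))$. *)

(* Defs.v *)
From HB Require Import structures.
From mathcomp Require Import all_boot all_order ssralg ssrnum ssrint.
From mathcomp Require Import finmap.
From mathcomp Require Import boolp.
From mathcomp Require Import zify.

Set Implicit Arguments.
Unset Strict Implicit.
Unset Printing Implicit Defensive.

Import Order.TTheory.

Local Open Scope order_scope.
Local Open Scope fset_scope.

(* The display of an [orderType] only steers the printing of notations (it is
   a pair of elements of [unit]), so fixing it does not restrict the class of
   linear orders. *)
Definition lo_display : Order.disp_t := Order.Disp tt tt.

Notation LO := (orderType lo_display).

Definition order_embedding (X Y : LO) (f : X -> Y) : Prop :=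
  {mono f : x y / x < y}.

Record emb (X Y : LO) : Type := Emb {
  emb_fun :> X -> Y;
  emb_mono : order_embedding emb_fun
}.

Definition emb_id (X : LO) : emb X X := @Emb X X id (fun _ _ => erefl).

Lemma emb_comp_mono (X Y Z : LO) (g : emb Y Z) (f : emb X Y) :
  order_embedding (g \o f).
Proof. by move=> x y /=; rewrite !emb_mono. Qed.

Definition emb_comp (X Y Z : LO) (g : emb Y Z) (f : emb X Y) : emb X Z :=
  Emb (emb_comp_mono g f).

Record LO_dilator : Type := LODilator {
  dil_obj :> LO -> LO;
  dil_map : forall X Y : LO, emb X Y -> emb (dil_obj X) (dil_obj Y);
  dil_supp : forall X : LO, dil_obj X -> {fset X};
  dil_map_id : forall X : LO, dil_map (emb_id X) =1 id;
  dil_map_comp : forall (X Y Z : LO) (g : emb Y Z) (f : emb X Y),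
    dil_map (emb_comp g f) =1 dil_map g \o dil_map f;
  dil_supp_nat : forall (X Y : LO) (f : emb X Y) (s : dil_obj X),
    dil_supp (dil_map f s) = [fset f x | x in dil_supp s];
  dil_supp_range : forall (X Y : LO) (f : emb X Y) (s : dil_obj Y),
    (forall y, y \in dil_supp s -> exists x, f x = y) ->
    exists r, dil_map f r = s
}.

Record BH_fixed_point (D : LO_dilator) (X Z : LO)
    (iota : X -> Z) (theta : D Z -> Z) : Prop := BHFixedPoint {
  BH_iota_emb : order_embedding iota;
  BH_iota_lt : forall (x : X) (s : D Z), iota x < theta s;
  BH_theta_lt : forall s t : D Z, s < t ->
    (forall z, z \in dil_supp s -> z < theta t) -> theta s < theta t;
  BH_supp_lt : forall (s : D Z) (z : Z), z \in dil_supp s -> z < theta s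
}.

Definition initial_BH_fixed_point (D : LO_dilator) (X Z : LO)
    (iota : X -> Z) (theta : D Z -> Z) : Prop :=
  BH_fixed_point iota theta /\
  forall (Z' : LO) (iota' : X -> Z') (theta' : D Z' -> Z'),
    BH_fixed_point iota' theta' ->
    exists! f : emb Z Z',
      f \o iota =1 iota' /\ f \o theta =1 theta' \o dil_map D f.

Record BH_derivative (D E : LO_dilator)
    (iota : forall X : LO, X -> E X)
    (theta : forall X : LO, D (E X) -> E X) : Prop := BHDerivative {
  BH_der_initial : forall X : LO, initial_BH_fixed_point (@iota X) (@theta X);
  BH_der_iota : forall (X Y : LO) (f : emb X Y),
    dil_map E f \o @iota X =1 @iota Y \o f;
  BH_der_theta : forall (X Y : LO) (f : emb X Y),
    dil_map E f \o @theta X =1 @theta Y \o dil_map D (dil_map E f)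
}.

(* Raw terms: the simultaneous recursion for T(X) and S is split into the raw
   syntax, the function [S_] on it, and the side condition on [Theta i s],
   which is imposed by [in_T] below. *)
Inductive term (X : Type) : Type :=
| Var of X
| Theta of nat & term X.

Section TermChoice.
Variable X : Type.

Fixpoint term_code (s : term X) : X * seq nat :=
  match s with
  | Var x => (x, [::])
  | Theta i s => ((term_code s).1, i :: (term_code s).2)
  end.

Definition term_decode (c : X * seq nat) : term X :=
  foldr (@Theta X) (Var c.1) c.2.

Lemma term_codeK : cancel term_code term_decode.
Proof.
elim=> [x|i s IHs] //=.
by rewrite -[in RHS]IHs; case: (term_code s).
Qed.

End TermChoice.

HB.instance Definition _ (X : eqType) :=
  Equality.copy (term X) (can_type (@term_codeK X)).
HB.instance Definition _ (X : choiceType) :=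
  Choice.copy (term X) (can_type (@term_codeK X)).

Section Terms.
Variable X : Type.
Implicit Types (s t : term X) (i : int).

(* Elements of N u {-1} are represented in [int]. *)
Definition S_ s : int :=
  match s with
  | Var _ => (-1)%R
  | Theta i _ => Posz i
  end.

Fixpoint k_ i s : term X :=
  match s with
  | Var x => Var x
  | Theta j s' => if (Posz j <= i)%R then s else k_ i s'
  end.

Fixpoint in_T s : bool :=
  match s with
  | Var _ => true
  | Theta i s' => in_T s' && (Num.max (S_ s' - 1) 0 <= Posz i)%R
  end.

Fixpoint indices_lt (n : nat) s : bool :=
  match s with
  | Var _ => true
  | Theta i s' => (i < n)%N && indices_lt n s'
  end.

(* The predicates [in_T], [in_Tn n] and [in_T0n n] carve T(X), T_n(X) and
   T^0_n(X) out of the raw terms. *)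
Definition in_Tn (n : nat) s : bool := in_T s && indices_lt n s.

Definition in_T0n (n : nat) s : bool := in_Tn n s && (S_ s <= 0)%R.

Lemma k_neg1 s : {x : X | k_ (-1)%R s = Var x}.
Proof. by elim: s => [x|i s [x IHs]]; exists x. Qed.

Definition kbar s : X := sval (k_neg1 s).

Lemma kbar_Var x : kbar (Var x) = x.
Proof. by rewrite /kbar; case: k_neg1 => y /= []. Qed.

Lemma kbar_Theta j s : kbar (Theta j s) = kbar s.
Proof.
rewrite /kbar; case: (k_neg1 s) => y /= ys.
by case: k_neg1 => z /=; rewrite ys => -[].
Qed.

End Terms.

(* The recursive clauses only use the relation positively and on pairs of
   smaller total size, so the least relation closed under them is the one
   defined by recursion.  It is linear already on raw terms. *)
Inductive term_lt (X : LO) : term X -> term X -> Prop :=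
| lt_Var_Var (x y : X) : x < y -> term_lt (Var x) (Var y)
| lt_Var_Theta (x : X) (j : nat) (t : term X) : term_lt (Var x) (Theta j t)
| lt_index (i j : nat) (s t : term X) :
    (i < j)%N -> term_lt (Theta i s) (Theta j t)
| lt_arg (i : nat) (s t : term X) :
    term_lt s t -> term_lt (k_ (Posz i) s) (Theta i t) ->
    term_lt (Theta i s) (Theta i t)
| lt_le_k (i : nat) (s t : term X) :
    term_lt (Theta i s) (k_ (Posz i) t) \/ Theta i s = k_ (Posz i) t ->
    term_lt (Theta i s) (Theta i t).

Section TermOrder.
Variable X : LO.
Implicit Types (s t u : term X) (i j : nat).

Fixpoint term_size s : nat :=
  if s is Theta _ s' then (term_size s').+1 else 0%N.

Lemma term_size_k (i : int) s : (term_size (k_ i s) <= term_size s)%N.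
Proof. by elim: s => //= j s IHs; case: ifP => // _; apply: leqW. Qed.

Lemma term_lt_ThetaE i j s t : term_lt (Theta i s) (Theta j t) <->
  (i < j)%N \/ i = j /\
    (term_lt s t /\ term_lt (k_ (Posz i) s) (Theta j t) \/
     (term_lt (Theta i s) (k_ (Posz j) t) \/ Theta i s = k_ (Posz j) t)).
Proof.
split=> [lt_st|].
- inversion lt_st; subst; first by left.
  + by right; split=> //; left.
  + by right; split=> //; right.
- case=> [|[<- [[]|]]]; [exact: lt_index|exact: lt_arg|exact: lt_le_k].
Qed.

Lemma term_lt_VarE (x y : X) : term_lt (Var x) (Var y) <-> x < y.
Proof. by split=> [lt_xy|]; [inversion lt_xy|exact: lt_Var_Var]. Qed.

Lemma not_term_lt_Theta_Var i s x : ~ term_lt (Theta i s) (Var x).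
Proof. by move=> lt_sx; inversion lt_sx. Qed.

Lemma k_lt_Theta i s : term_lt (k_ (Posz i) s) (Theta i s).
Proof.
have: (exists x, k_ (Posz i) s = Var x) \/
      exists j t, (j <= i)%N /\ k_ (Posz i) s = Theta j t.
  elim: s => [x|j s IHs] /=; first by left; exists x.
  by case: ifP => // le_ji; right; exists j, s.
case=> [[x ->]|[j [t [le_ji eq_k]]]]; first exact: lt_Var_Theta.
rewrite eq_k; case: (ltngtP j i) le_ji => // [lt_ji|eq_ji] _.
  exact: lt_index.
by apply/term_lt_ThetaE; right; split=> //; right; right; rewrite eq_k.
Qed.

Lemma term_lt_trans s t u : term_lt s t -> term_lt t u -> term_lt s u.
Proof.
move: {2}(_ + _ + _)%N (leqnn (term_size s + term_size t + term_size u)) => n.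
elim: n s t u => [|n IHn] [x|i s] [y|j t] [z|l u] //= le_n;
  try by [constructor | move/not_term_lt_Theta_Var | move=> _ /not_term_lt_Theta_Var].
- by rewrite !term_lt_VarE; apply: lt_trans.
- by rewrite !term_lt_VarE; apply: lt_trans.
have ks := term_size_k (Posz i) s; have kt := term_size_k (Posz j) t.
have ku := term_size_k (Posz l) u.
move=> lt_st lt_tu; move: (lt_st) (lt_tu) => /term_lt_ThetaE lst /term_lt_ThetaE ltu.
apply/term_lt_ThetaE.
case: lst ltu => [lt_ij|[eq_ij lst]] [lt_jl|[eq_jl ltu]]; try by left; lia.
right; split; first by lia.
subst j l; case: ltu => [[lt_tu' lt_ktu]|le_tku].
  case: lst => [[lt_st' lt_kst]|le_skt].
    left; split; first by apply: (IHn s t u) => //; lia.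
    by apply: (IHn _ (Theta i t)) => //=; lia.
  have: term_lt (Theta i s) (Theta i u).
    case: le_skt => [lt_skt|->//].
    by apply: (IHn _ (k_ (Posz i) t)) => //=; lia.
  by move/term_lt_ThetaE => [|[_]]; rewrite ?ltnn.
right; left.
case: le_tku => [lt_tku|<-//].
by apply: (IHn _ (Theta i t)) => //=; lia.
Qed.

Lemma term_lt_irr s : ~ term_lt s s.
Proof.
move: {2}(term_size s) (leqnn (term_size s)) => n.
elim: n s => [|n IHn] [x|i s] //= le_n;
  try by rewrite term_lt_VarE ltxx.
have ks := term_size_k (Posz i) s.
move=> /term_lt_ThetaE [|[_ [[lt_ss _]|]]]; first by rewrite ltnn.
  exact: IHn lt_ss.
case=> [lt_sk|eq_sk]; last by move: ks; rewrite -eq_sk /= ltnn.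
apply: (IHn (k_ (Posz i) s)); first by lia.
exact: term_lt_trans (k_lt_Theta i s) lt_sk.
Qed.

Lemma term_lt_total s t : [\/ term_lt s t, s = t | term_lt t s].
Proof.
move: {2}(_ + _)%N (leqnn (term_size s + term_size t)) => n.
elim: n s t => [|n IHn] [x|i s] [y|j t] //= le_n;
  try by [constructor 1; constructor | constructor 3; constructor].
- case: (ltgtP x y) => [lt_xy|lt_yx|->]; last by constructor 2.
    by constructor 1; constructor.
  by constructor 3; constructor.
- case: (ltgtP x y) => [lt_xy|lt_yx|->]; last by constructor 2.
    by constructor 1; constructor.
  by constructor 3; constructor.
have ks := term_size_k (Posz i) s; have kt := term_size_k (Posz j) t.
case: (ltngtP i j) => [lt_ij|lt_ji|eq_ij]; first by constructor 1; constructor.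
  by constructor 3; constructor.
subst j; case: (IHn s t) => [|lt_st|->|lt_ts]; first by lia.
- case: (IHn (k_ (Posz i) s) (Theta i t)) => /= [|lt_k|eq_k|gt_k]; first by lia.
  + by constructor 1; apply: lt_arg.
  + by constructor 3; apply: lt_le_k; right.
  + by constructor 3; apply: lt_le_k; left.
- by constructor 2.
- case: (IHn (k_ (Posz i) t) (Theta i s)) => /= [|lt_k|eq_k|gt_k]; first by lia.
  + by constructor 3; apply: lt_arg.
  + by constructor 1; apply: lt_le_k; right.
  + by constructor 1; apply: lt_le_k; left.
Qed.

Definition term_ltb : rel (term X) := fun s t => `[< term_lt s t >].
Definition term_leb : rel (term X) := fun s t => (s == t) || term_ltb s t.

Lemma term_ltb_irr : irreflexive term_ltb.
Proof. by move=> s; apply/asboolP/term_lt_irr. Qed.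

Lemma term_ltb_trans : transitive term_ltb.
Proof. by move=> t s u /asboolP st /asboolP tu; apply/asboolP/(term_lt_trans st). Qed.

Lemma term_ltb_total s t : s != t -> term_ltb s t || term_ltb t s.
Proof.
by move=> /eqP neq_st; case: (term_lt_total s t) => // /asboolP lt;
  apply/orP; [left|right].
Qed.

End TermOrder.

HB.instance Definition _ (X : LO) := Order.LtOrder.Build lo_display (term X)
  (fun _ _ => erefl) (fun _ _ => erefl) (fun _ _ => erefl)
  (@term_ltb_irr X) (@term_ltb_trans X) (@term_ltb_total X).

Lemma term_ltP (X : LO) (s t : term X) : reflect (term_lt s t) (s < t).
Proof. exact: asboolP. Qed.

Fixpoint T_map (X Y : Type) (f : X -> Y) (s : term X) : term Y :=
  match s with
  | Var x => Var (f x)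
  | Theta i s' => Theta i (T_map f s')
  end.

Section TMap.
Variables X Y : Type.
Implicit Types (f : X -> Y) (s : term X).

Lemma S_T_map f s : S_ (T_map f s) = S_ s.
Proof. by case: s. Qed.

Lemma k_T_map f (i : int) s : k_ i (T_map f s) = T_map f (k_ i s).
Proof. by elim: s => //= j s ->; case: ifP. Qed.

Lemma kbar_T_map f s : kbar (T_map f s) = f (kbar s).
Proof. by elim: s => [x|i s IHs] /=; rewrite ?kbar_Var ?kbar_Theta. Qed.

Lemma in_T_map f s : in_T (T_map f s) = in_T s.
Proof. by elim: s => //= i s ->; rewrite S_T_map. Qed.

Lemma indices_lt_T_map f n s : indices_lt n (T_map f s) = indices_lt n s.
Proof. by elim: s => //= i s ->. Qed.

Lemma in_T0n_map f n s : in_T0n n (T_map f s) = in_T0n n s.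
Proof. by rewrite /in_T0n /in_Tn in_T_map indices_lt_T_map S_T_map. Qed.

Lemma T_map_range f (t : term Y) x : f x = kbar t -> exists s, T_map f s = t.
Proof.
elim: t => [y|i t IHt]; first by rewrite kbar_Var => <-; exists (Var x).
by rewrite kbar_Theta => /IHt[s <-]; exists (Theta i s).
Qed.

End TMap.

Lemma T_map_id X : @T_map X X id =1 id.
Proof. by elim=> //= i s ->. Qed.

Lemma T_map_comp X Y Z (g : Y -> Z) (f : X -> Y) :
  T_map (g \o f) =1 T_map g \o T_map f.
Proof. by elim=> //= i s ->. Qed.

Lemma T_map_homo (X Y : LO) (f : emb X Y) (s t : term X) :
  term_lt s t -> term_lt (T_map f s) (T_map f t).
Proof.
move: {2}(_ + _)%N (leqnn (term_size s + term_size t)) => n.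
elim: n s t => [|n IHn] [x|i s] [y|j t] //= le_n;
  try by [constructor | move/not_term_lt_Theta_Var].
- by rewrite !term_lt_VarE emb_mono.
- by rewrite !term_lt_VarE emb_mono.
have ks := term_size_k (Posz i) s; have kt := term_size_k (Posz j) t.
rewrite !term_lt_ThetaE !k_T_map; case=> [|[eq_ij lt]]; [by left|right].
split=> //; case: lt => [[lt_st lt_k]|[lt_k|eq_k]]; [left|right; left|right; right].
- by split; [apply: IHn => //; lia|apply: (IHn _ (Theta j t)) => //=; lia].
- by apply: (IHn (Theta i s)) => //=; lia.
- by rewrite -eq_k.
Qed.

Lemma T_map_mono (X Y : LO) (f : emb X Y) :
  {mono (T_map f : term X -> term Y) : s t / s < t}.
Proof.
apply: leW_mono; apply: le_mono => s t /term_ltP lt_st.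
exact/term_ltP/T_map_homo.
Qed.

Definition Tn (n : nat) (X : Type) : Type := {s : term X | in_Tn n s}.
Definition T0n (n : nat) (X : Type) : Type := {s : term X | in_T0n n s}.

HB.instance Definition _ n (X : LO) := SubChoice.on (Tn n X).
HB.instance Definition _ n (X : LO) :=
  [SubChoice_isSubOrder of Tn n X by <: with lo_display].
HB.instance Definition _ n (X : LO) := SubChoice.on (T0n n X).
HB.instance Definition _ n (X : LO) :=
  [SubChoice_isSubOrder of T0n n X by <: with lo_display].

Section T0nDilator.
Variable n : nat.

Lemma T0n_map_subproof X Y (f : X -> Y) (s : T0n n X) :
  in_T0n n (T_map f (val s)).
Proof. by rewrite in_T0n_map (valP s). Qed.

Definition T0n_fun X Y (f : X -> Y) (s : T0n n X) : T0n n Y :=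
  exist _ (T_map f (val s)) (T0n_map_subproof f s).

Lemma T0n_fun_mono (X Y : LO) (f : emb X Y) :
  @order_embedding (T0n n X) (T0n n Y) (T0n_fun f).
Proof. by move=> s t; rewrite -!lt_val /= T_map_mono. Qed.

Definition T0n_map (X Y : LO) (f : emb X Y) : emb (T0n n X) (T0n n Y) :=
  Emb (T0n_fun_mono f).

Definition T0n_supp (X : LO) (s : T0n n X) : {fset X} := [fset kbar (val s)].

Lemma T0n_map_id (X : LO) : T0n_map (emb_id X) =1 id.
Proof. by move=> s; apply: val_inj; rewrite /= T_map_id. Qed.

Lemma T0n_map_comp (X Y Z : LO) (g : emb Y Z) (f : emb X Y) :
  T0n_map (emb_comp g f) =1 T0n_map g \o T0n_map f.
Proof. by move=> s; apply: val_inj; rewrite /= T_map_comp. Qed.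

Lemma T0n_supp_nat (X Y : LO) (f : emb X Y) (s : T0n n X) :
  T0n_supp (T0n_map f s) = [fset f x | x in T0n_supp s].
Proof.
apply/fsetP=> y; rewrite /T0n_supp /= kbar_T_map inE; apply/eqP/imfsetP.
  by move=> ->; exists (kbar (val s)); rewrite //= inE.
by case=> x /=; rewrite inE => /eqP-> ->.
Qed.

Lemma T0n_supp_range (X Y : LO) (f : emb X Y) (s : T0n n Y) :
  (forall y, y \in T0n_supp s -> exists x, f x = y) ->
  exists r, T0n_map f r = s.
Proof.
move=> supp_s; have [|x] := supp_s (kbar (val s)); first by rewrite inE.
move=> fx_s; have [r def_s] := T_map_range fx_s.
have rP: in_T0n n r by rewrite -(in_T0n_map f) def_s (valP s).
by exists (exist _ r rP); apply: val_inj.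
Qed.

Definition T0n_dilator : LO_dilator :=
  LODilator T0n_map_id T0n_map_comp T0n_supp_nat T0n_supp_range.

End T0nDilator.

Section Sigma.
Variables (n : nat) (X : Type).

Fixpoint sigma_term (s : term (T0n n.+1 X)) : term X :=
  match s with
  | Var r => val r
  | Theta i s' => Theta i.+1 (sigma_term s')
  end.

Lemma S_sigma_term s : (S_ (sigma_term s) <= S_ s + 1)%R.
Proof. by case: s => [[r /andP[]]|i s] //=; lia. Qed.

Lemma sigma_subproof (s : Tn n (T0n n.+1 X)) :
  in_Tn n.+1 (sigma_term (val s)).
Proof.
case: s => s /=; elim: s => [[r /= /andP[]]|i s IHs] //=.
rewrite /in_Tn /= => /andP[/andP[inTs le_Si] /andP[lt_in ind_s]].
have /andP[-> ->] := IHs (introT andP (conj inTs ind_s)).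
by have := S_sigma_term s; lia.
Qed.

Definition sigma (s : Tn n (T0n n.+1 X)) : Tn n.+1 X :=
  exist _ (sigma_term (val s)) (sigma_subproof s).

Lemma T0n_sub_Tn m Y (s : T0n m Y) : in_Tn m (val s).
Proof. by case: s => s /= /andP[]. Qed.

Definition T0n_Tn m Y (s : T0n m Y) : Tn m Y := exist _ (val s) (T0n_sub_Tn s).

Lemma vartheta_subproof (s : T0n n (T0n n.+1 X)) :
  in_T0n n.+1 (Theta 0 (val (sigma (T0n_Tn s)))).
Proof.
have := valP (sigma (T0n_Tn s)); have := S_sigma_term (val s).
case: s => s /= /andP[_ le_S0] le_S1 /andP[inT ind].
by rewrite /in_T0n /in_Tn /= inT ind; lia.
Qed.

Definition vartheta_n (s : T0n n (T0n n.+1 X)) : T0n n.+1 X :=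
  exist _ (Theta 0 (val (sigma (T0n_Tn s)))) (vartheta_subproof s).

Definition iota_n (x : X) : T0n n.+1 X := exist _ (Var x) isT.

End Sigma.

(* Main.v *)
(** The map [sigma] identifies T_n(T^0_{n+1}(X)) with T_{n+1}(X): it shifts
    indices by one and turns [k_i] into [k_(i+1)], and [k_(-1)] into [k_0].
    Hence [vartheta_n] hits exactly the terms [Theta 0 t], and the
    Bachmann-Howard conditions become the clauses that define the order for
    index 0.  Given another fixed point [(Z, iota', theta')], the inverse of
    [sigma] followed by the map T(f) induced by the unknown morphism f can be
    defined directly by structural recursion on raw terms ([collapse]);
    on terms of T^0_{n+1}(X) it yields a variable, whose content is the value
    of f. *)
Require Import Defs.
From mathcomp Require Import all_boot all_order.
From mathcomp Require Import ssralg ssrnum ssrint finmap boolp zify.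

Set Implicit Arguments.
Unset Strict Implicit.
Unset Printing Implicit Defensive.

Import Order.TTheory.

Local Open Scope order_scope.

Lemma emb_ext (X Y : LO) (f g : emb X Y) : f =1 g -> f = g.
Proof.
case: f g => f fP [g gP] /= /funext eq_fg; subst g.
by rewrite (Prop_irrelevance fP gP).
Qed.

Lemma k_id (X : Type) (i : int) (t : term X) : (S_ t <= i)%R -> k_ i t = t.
Proof. by case: t => //= j t ->. Qed.

Lemma in_Tn_Theta (X : Type) n i (t : term X) :
  in_Tn n (Theta i t) = [&& in_Tn n t, (S_ t - 1 <= Posz i)%R & (i < n)%N].
Proof. by rewrite /in_Tn /=; lia. Qed.

Lemma in_Tn_k (X : Type) n (i : int) (t : term X) :
  in_Tn n t -> in_Tn n (k_ i t).
Proof.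
elim: t => //= j t IHt tP; case: ifP => // _.
by apply: IHt; move: tP; rewrite in_Tn_Theta => /andP[].
Qed.

(* The generated principle [term_lt_ind] lacks an induction hypothesis for the
   disjunction in [lt_le_k]. *)
Lemma term_lt_strong_ind (X : LO) (P : term X -> term X -> Prop) :
    (forall x y, x < y -> P (Var x) (Var y)) ->
    (forall x j t, P (Var x) (Theta j t)) ->
    (forall i j s t, (i < j)%N -> P (Theta i s) (Theta j t)) ->
    (forall i s t, P s t -> P (k_ (Posz i) s) (Theta i t) ->
      P (Theta i s) (Theta i t)) ->
    (forall i s t, P (Theta i s) (k_ (Posz i) t) ->
      P (Theta i s) (Theta i t)) ->
    (forall i s t, Theta i s = k_ (Posz i) t -> P (Theta i s) (Theta i t)) ->
  forall s t, term_lt s t -> P s t.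
Proof.
move=> PVV PVT Pidx Parg Plt Peq; fix IH 3 => s t.
case=> {s t} [x y|x j t|i j s t|i s t lt_st lt_k|i s t [lt_k|eq_k]];
  [exact: PVV|exact: PVT|exact: Pidx|exact: Parg (IH _ _ lt_st) (IH _ _ lt_k)
  |exact: Plt (IH _ _ lt_k)|exact: Peq].
Qed.

(** * The shift [sigma_term] and the fixed point it yields *)

Section SigmaTerm.
Variables (n : nat).

(** Converse to [S_sigma_term], used to recover a bound on [s] from one on its image. The maximum
    covers [s = Var r], whose image may have [S_] equal to -1. *)
Lemma S_sigma_term_ge (X : Type) (s : term (T0n n.+1 X)) :
  (S_ s + 1 <= Num.max (S_ (sigma_term s)) 0)%R.
Proof. by case: s => [r|i s] /=; lia. Qed.

(** All indices that [sigma_term] puts above the leaf [r] are positive, so [k_ 0] strips exactly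
    these and stops at [val r], whose [S_] is at most 0. *)
Lemma k0_sigma_term (X : Type) (s : term (T0n n.+1 X)) :
  k_ 0%R (sigma_term s) = val (kbar s).
Proof.
elim: s => [r|i s IHs] /=; last by rewrite kbar_Theta.
by rewrite kbar_Var k_id //; case/andP: (valP r).
Qed.

Lemma k_sigma_term (X : Type) i (s : term (T0n n.+1 X)) :
  k_ (Posz i.+1) (sigma_term s) = sigma_term (k_ (Posz i) s).
Proof.
elim: s => [r|j s IHs] /=; last by case: ifP => //; case: ifP => //; lia.
by rewrite k_id //; case/andP: (valP r) => _ /le_trans; apply.
Qed.

Lemma sigma_term_homo (X : LO) (s t : term (T0n n.+1 X)) :
  term_lt s t -> term_lt (sigma_term s) (sigma_term t).
Proof.
move: s t; apply: term_lt_strong_ind => /=.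
- by move=> r u; rewrite -lt_val => /term_ltP.
- case=> [[x|i u] rP] j t /=; first exact: lt_Var_Theta.
  (* A non-variable element of T^0 has outermost index 0, below the shifted index [j.+1]. *)
  by case/andP: rP => _ /= le_i0; apply: lt_index; lia.
- by move=> i j s t lt_ij; apply: lt_index.
- by move=> i s t lt_st lt_k; apply: lt_arg; rewrite // k_sigma_term.
- by move=> i s t lt_k; apply: lt_le_k; left; rewrite k_sigma_term.
- by move=> i s t eq_k; apply: lt_le_k; right; rewrite k_sigma_term -eq_k.
Qed.

Lemma sigma_term_T_map (X Y : LO) (f : emb X Y) (s : term (T0n n.+1 X)) :
  sigma_term (T_map (T0n_map n.+1 f) s) = T_map f (sigma_term s).
Proof. by elim: s => //= i s ->. Qed.

Lemma vartheta_n_BH_fixed_point (X : LO) :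
  @BH_fixed_point (T0n_dilator n) X (T0n n.+1 X) (@iota_n n X) (@vartheta_n n X).
Proof.
split=> [x y|x s|s t lt_st supp_lt|s z].
- by rewrite -lt_val /=; apply/term_ltP/idP => /term_lt_VarE.
- by rewrite -lt_val /=; apply/term_ltP/lt_Var_Theta.
- rewrite -lt_val /=; apply/term_ltP/lt_arg.
    by apply/sigma_term_homo/term_ltP; rewrite -lt_val in lt_st.
  rewrite k0_sigma_term; apply/term_ltP.
  by have := supp_lt (kbar (val s)); rewrite -lt_val; apply; rewrite inE.
- rewrite inE => /eqP->; rewrite -lt_val /=; apply/term_ltP.
  by rewrite -k0_sigma_term; apply: k_lt_Theta.
Qed.

End SigmaTerm.

(** * The unique morphism into an arbitrary fixed point *)

Section Collapse.
Variables (n : nat) (X Z : LO) (iota' : X -> Z) (theta' : T0n n Z -> Z).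

Definition T0n_Var (z : Z) : T0n n Z := exist _ (Var z) isT.

(* Arguments outside T^0_n(Z) do not occur for the terms of interest; for
   these, [insubd] falls back to a junk value. *)
Fixpoint collapse (t : term X) : term Z :=
  match t with
  | Var x => Var (iota' x)
  | Theta 0 t' =>
      Var (theta' (insubd (T0n_Var (kbar (collapse t'))) (collapse t')))
  | Theta i.+1 t' => Theta i (collapse t')
  end.

Lemma k_collapse i (t : term X) :
  collapse (k_ (Posz i.+1) t) = k_ (Posz i) (collapse t).
Proof.
by elim: t => //= -[|j] t IHt //=; case: ifP => //; case: ifP => //; lia.
Qed.

(** Subterms with outermost index 0 become variables, so [k_ 0] on the source corresponds to
    [k_ (-1)] on the target. *)
Lemma collapse_k0 (t : term X) : collapse (k_ 0%R t) = Var (kbar (collapse t)).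
Proof. by elim: t => [x|[|j] t IHt] //=; rewrite ?kbar_Var ?kbar_Theta. Qed.

Lemma S_collapse (t : term X) : S_ (collapse t) = Num.max (S_ t - 1)%R (-1)%R.
Proof. by case: t => [x|[|i] t] //=; lia. Qed.

Lemma in_Tn_collapse (t : term X) : in_Tn n.+1 t -> in_Tn n (collapse t).
Proof.
elim: t => // -[|i] t IHt; rewrite in_Tn_Theta => /and3P[tP le_S lt_in] //=.
by rewrite in_Tn_Theta IHt // S_collapse /=; lia.
Qed.

Lemma in_T0n_collapse (t : term X) :
  in_Tn n.+1 (Theta 0 t) -> in_T0n n (collapse t).
Proof.
rewrite in_Tn_Theta => /and3P[tP le_S _].
by rewrite /in_T0n in_Tn_collapse // S_collapse; lia.
Qed.

(** Induction on the derivation. Between equal positive indices each clause turns into the same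
    clause one index lower, by [k_collapse]; at index 0 the clauses turn into the fixed point
    conditions on [theta']. *)
Lemma collapse_homo (s t : term X) :
    @BH_fixed_point (T0n_dilator n) X Z iota' theta' ->
  in_Tn n.+1 s -> in_Tn n.+1 t ->
  term_lt s t -> term_lt (collapse s) (collapse t).
Proof.
case=> iota_emb iota_lt theta_lt supp_lt sP tP lt_st.
elim/term_lt_strong_ind: s t / lt_st sP tP.
- by move=> x y lt_xy _ _; apply/term_lt_VarE; rewrite iota_emb.
- by move=> x [|j] t _ _; [apply/term_lt_VarE/iota_lt|apply: lt_Var_Theta].
- by move=> [|i] [|j] s t //= lt_ij _ _; [apply: lt_Var_Theta|apply: lt_index].
- move=> [|i] s t IHst IHk sP tP; last first.
    move: (sP) (tP); rewrite !in_Tn_Theta => /andP[sP' _] /andP[tP' _].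
    apply: lt_arg; first exact: IHst.
    by rewrite -k_collapse; apply: IHk; rewrite ?in_Tn_k.
  have [s0P t0P] := (in_T0n_collapse sP, in_T0n_collapse tP).
  move: (sP) (tP); rewrite !in_Tn_Theta => /andP[sP' _] /andP[tP' _].
  apply/term_lt_VarE/theta_lt => [|z].
    by rewrite -lt_val !val_insubd s0P t0P; apply/term_ltP/IHst.
  rewrite inE val_insubd s0P => /eqP->; apply/term_lt_VarE.
  by rewrite -collapse_k0; apply: IHk; rewrite ?in_Tn_k.
- move=> [|i] s t IHk sP tP; last first.
    move: (tP); rewrite !in_Tn_Theta => /andP[tP' _].
    by apply: lt_le_k; left; rewrite -k_collapse; apply: IHk; rewrite ?in_Tn_k.
  have t0P := in_T0n_collapse tP.
  move: (tP); rewrite in_Tn_Theta => /andP[tP' _].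
  (* [theta'] exceeds the only support element of its argument, which by [collapse_k0] is the
     content of this middle term. *)
  apply: (@term_lt_trans _ _ (collapse (k_ 0%R t))).
    by apply: IHk; rewrite ?in_Tn_k.
  rewrite collapse_k0; apply/term_lt_VarE/supp_lt.
  by rewrite inE val_insubd t0P.
- move=> [|i] s t eq_k sP tP; last first.
    by apply: lt_le_k; right; rewrite -k_collapse -eq_k.
  have t0P := in_T0n_collapse tP.
  rewrite {1}eq_k collapse_k0; apply/term_lt_VarE/supp_lt.
  by rewrite inE val_insubd t0P.
Qed.

Definition collapse_T0n (t : T0n n.+1 X) : Z := kbar (collapse (val t)).

Lemma collapse_val (t : T0n n.+1 X) : collapse (val t) = Var (collapse_T0n t).
Proof.
by rewrite /collapse_T0n -collapse_k0 k_id //; case/andP: (valP t).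
Qed.

Lemma collapse_sigma_term (s : term (T0n n.+1 X)) :
  collapse (sigma_term s) = T_map collapse_T0n s.
Proof. by elim: s => [r|i s IHs] /=; [exact: collapse_val|rewrite IHs]. Qed.

Lemma collapse_vartheta_n (s : T0n n (T0n n.+1 X)) :
  collapse_T0n (vartheta_n s) = theta' (T0n_fun collapse_T0n s).
Proof.
rewrite /collapse_T0n /= kbar_Var collapse_sigma_term; congr theta'.
by apply: val_inj; rewrite val_insubd in_T0n_map (valP s).
Qed.

Lemma collapse_T0n_mono :
    @BH_fixed_point (T0n_dilator n) X Z iota' theta' ->
  @order_embedding (T0n n.+1 X) Z collapse_T0n.
Proof.
move=> fpZ; apply: leW_mono; apply: le_mono => s t.
rewrite -lt_val => /term_ltP lt_st; apply/term_lt_VarE.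
by rewrite -!collapse_val; apply: collapse_homo => //; apply: T0n_sub_Tn.
Qed.

(* Surjectivity of [sigma] and uniqueness of the morphism [h] are proved
   together: both amount to recovering [t] from smaller terms. *)
Lemma sigma_term_collapse (h : T0n n.+1 X -> Z) :
    h \o @iota_n n X =1 iota' ->
    h \o @vartheta_n n X =1 theta' \o T0n_fun h ->
  forall t, in_Tn n.+1 t ->
  exists s, [/\ in_Tn n s, sigma_term s = t & T_map h s = collapse t].
Proof.
move=> h_iota h_theta; elim=> [x|i t IHt] tP.
  by exists (Var (iota_n n x)); rewrite /= -h_iota.
move: tP; rewrite in_Tn_Theta => /and3P[/IHt[s [sP <- eq_hs]] le_S lt_in].
have le_sigma := S_sigma_term_ge s.
case: i le_S lt_in => [|i] le_S lt_in; last first.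
  by exists (Theta i s); rewrite /= eq_hs in_Tn_Theta sP; split=> //; lia.
have s0P : in_T0n n s by rewrite /in_T0n sP; lia.
pose s0 : T0n n (T0n n.+1 X) := exist _ s s0P.
(* At index 0 the term itself lies in T^0, so a variable serves as its preimage. *)
exists (Var (vartheta_n s0)); split=> //=; congr Var.
rewrite [LHS]h_theta; congr theta'; apply: val_inj.
by rewrite val_insubd -eq_hs in_T0n_map s0P.
Qed.

Lemma collapse_T0n_unique (h : T0n n.+1 X -> Z) :
    h \o @iota_n n X =1 iota' ->
    h \o @vartheta_n n X =1 theta' \o T0n_fun h ->
  collapse_T0n =1 h.
Proof.
move=> h_iota h_theta t.
have [[r|i s] [_ def_t eq_hs]] :=
  sigma_term_collapse h_iota h_theta (T0n_sub_Tn t).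
  by rewrite /collapse_T0n -eq_hs kbar_Var; congr h; apply: val_inj.
(* The preimage cannot be [Theta i s]: its image has index [i.+1], while [S_] of [val t] is at most
   0. *)
by case/andP: (valP t) => _; rewrite -def_t.
Qed.

End Collapse.

Theorem theorem3p10 (n : nat) :
  @BH_derivative (T0n_dilator n) (T0n_dilator n.+1)
    (fun X : LO => @iota_n n X) (fun X : LO => @vartheta_n n X).
Proof.
split=> [X|X Y f x|X Y f s].
- split=> [|Z iota' theta' fpZ]; first exact: vartheta_n_BH_fixed_point.
  exists (Emb (collapse_T0n_mono fpZ)); split.
    split=> [x|s]; last exact: collapse_vartheta_n.
    by rewrite /= /collapse_T0n /= kbar_Var.
  by move=> h [h_iota h_theta]; apply/emb_ext/collapse_T0n_unique.
- exact: val_inj.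
- by apply: val_inj; rewrite /= sigma_term_T_map.
Qed.
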